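(* Let $n\ge 1$ and let $R=(r_1,\dots,r_n)$ and $S=(s_1,\dots,s_n)$ be vectors of nonnegative integers, all of whose components are at most $n$, with $\sum_i r_i=\sum_j s_j$. Then $\mathcal{A}^{+1}(R,S)\neq\emptyset$ if and only if $S=R^r$ and $R^r\preceq R^*$.
   Context: $R^r=(r_n,\dots,r_2,r_1)$ is the reversal of $R$. $\mathcal{A}^{+1}(R,S)$ is the set of $n\times n$ matrices $A$ with entries in $\{0,1\}$, with $i$th row sum $r_i$ and $j$th column sum $s_j$ for all $i,j$, that are invariant under the reflection $r_{+1}$ in the line of slope $+1$, i.e. $a_{i,j}=a_{n+1-j,\,n+1-i}$ for all $i,j$. For a nonnegative integer vector $R$, $R^*$ denotes the conjugate of (the weakly decreasing rearrangement of) $R$ viewed as an integer partition: its $k$th component is the number of $i$ with $r_i\ge k$. For nonnegative integer vectors $U,V$, $V\preceq U$ ($V$ is majorized by $U$) means that, after rearranging both in weakly decreasing order (and padding with zeros to a common length), $u_1+\dots+u_\ell\ge v_1+\dots+v_\ell$ for all $\ell$, and the total sums of $U$ and $V$ are equal. *)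

(* Defs.v *)
From mathcomp Require Import all_boot all_algebra.
Set Implicit Arguments.
Unset Strict Implicit.
Unset Printing Implicit Defensive.

(* Indices are 0-based, so rev_ord is the map i |-> n + 1 - i of the 1-based
   convention; entries in {0,1} are booleans, coerced to nat in the sums. *)
Definition refl_p1_class (n : nat) (R S : n.-tuple nat) : {set 'M[bool]_n} :=
  [set A : 'M[bool]_n |
    [&& [forall i : 'I_n, \sum_(j < n) A i j == tnth R i],
        [forall j : 'I_n, \sum_(i < n) A i j == tnth S j] &
        [forall i : 'I_n, forall j : 'I_n,
           A i j == A (rev_ord j) (rev_ord i)]]].

(* Only the components with k between 1 and the largest entry of R are listed;
   the later ones are 0. *)
Definition conjugate (R : seq nat) : seq nat :=
  [seq count (leq k) R | k <- iota 1 (\max_(r <- R) r)].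

(* V is majorized by U.  Padding with zeros is implicit: take l s is s as soon
   as l >= size s. *)
Definition majorized_by (V U : seq nat) : Prop :=
  (forall l : nat,
     sumn (take l (sort geq V)) <= sumn (take l (sort geq U))) /\
  sumn V = sumn U.

(* Main.v *)
(* Reversing the columns turns the class into the symmetric 0-1 matrices with
   row sums R, i.e. graphs with loops, a loop counting once in the degree of its
   vertex.  Since sum_(k <= l) R*_k = sum_i min(r_i, l), majorization says that
   the l largest r_i sum to at most sum_i min(r_i, l), which bounds the ones in
   any l rows by symmetry.  Conversely, as in the Tripathi-Venugopalan-West
   proof of the Erdos-Gallai theorem, the degrees are realized one at a time in
   decreasing order: a deficient row can be filled further by exchanging edges,
   unless the ones are placed so that the inequality for l = t.+1 fails. *)
Require Import Defs.
From mathcomp Require Import all_boot all_algebra.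
From mathcomp Require Import perm zify.

(** * Symmetric 0-1 matrices and edge exchanges *)

Definition mxsym {n} (A : 'M[bool]_n) := forall i j, A i j = A j i.

Definition rowsum {n} (A : 'M[bool]_n) (i : 'I_n) := \sum_(j < n) A i j.

Definition set_edge {n} (A : 'M[bool]_n) (x y : 'I_n) (b : bool) : 'M[bool]_n :=
  \matrix_(i, j) if (i == x) && (j == y) || (i == y) && (j == x) then b
                 else A i j.

(* Intended for p x an edge and p y a non-edge; p = x and p = y are allowed. *)
Definition rewire {n} (A : 'M[bool]_n) (p x y : 'I_n) :=
  set_edge (set_edge A p x false) p y true.

(* Makes the degree of a vertex beyond t count only neighbours at most t. *)
Definition null_beyond {n} (t : nat) (A : 'M[bool]_n) :=
  forall i j : 'I_n, t < i -> t < j -> A i j = false.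

Definition partial_realization {n} (r : 'I_n -> nat) (t : nat)
    (A : 'M[bool]_n) :=
  [/\ mxsym A, forall i, rowsum A i <= r i,
      forall i : 'I_n, i < t -> rowsum A i = r i & null_beyond t A].

Lemma mxsym_set_edge n (A : 'M[bool]_n) x y b : mxsym A -> mxsym (set_edge A x y b).
Proof.
move=> symA i j; rewrite !mxE (symA i j) orbC.
by rewrite (andbC (i == y)) (andbC (i == x)).
Qed.

Lemma mxsym_rewire n (A : 'M[bool]_n) p x y : mxsym A -> mxsym (rewire A p x y).
Proof. by move=> symA; do 2! apply: mxsym_set_edge. Qed.

Lemma null_beyond_set_edge n t (A : 'M[bool]_n) (x y : 'I_n) :
  null_beyond t A -> (x <= t) || (y <= t) -> null_beyond t (set_edge A x y true).
Proof.
move=> zA xy i j ti tj; rewrite mxE zA //; case: ifP => //.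
by case/orP=> /andP[/eqP ix /eqP jy]; move: xy ti tj; rewrite -ix -jy; lia.
Qed.

Lemma null_beyond_rewire n t (A : 'M[bool]_n) (p x y : 'I_n) :
  null_beyond t A -> (p <= t) || (y <= t) -> null_beyond t (rewire A p x y).
Proof.
move=> zA; apply: null_beyond_set_edge => i j ti tj.
by rewrite mxE zA // if_same.
Qed.

(** The old entry stands on the left to avoid truncated subtraction; the disjunction makes a loop,
    [x = y], count once. *)
Lemma rowsum_set_edge n (A : 'M[bool]_n) x y b k : mxsym A ->
  rowsum (set_edge A x y b) k + ((k == x) || (k == y)) * A x y =
  rowsum A k + ((k == x) || (k == y)) * b.
Proof.
move=> symA; have row1 u v (c : bool) :
    (forall j, j != v -> set_edge A x y b u j = A u j) ->
    set_edge A x y b u v = b ->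
    A u v = c -> rowsum (set_edge A x y b) u + c = rowsum A u + b.
  move=> off at_v <-; rewrite /rowsum (bigD1 v) //= at_v.
  rewrite [X in _ = X + _](bigD1 v) //=.
  by rewrite (eq_bigr (fun j => A u j : nat)) => [|j /off ->//]; lia.
have [->|kx] := eqVneq k x; last have [->|ky] := eqVneq k y; rewrite ?mul1n.
- apply: row1 => // [j jy|]; rewrite mxE !eqxx //= (negbTE jy) /=.
  by case: (eqVneq x y) => //= xy; rewrite xy (negbTE jy).
- apply: row1 => // [j jx|]; rewrite mxE !eqxx ?orbT // (negbTE jx) andbF /=.
  by case: (eqVneq y x) => //= xy; rewrite -xy in jx *; case: eqP jx.
by rewrite /= !addn0; apply: eq_bigr => j _; rewrite mxE (negbTE kx) (negbTE ky).
Qed.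

Lemma rowsum_add n (A : 'M[bool]_n) x y k : mxsym A -> A x y = false ->
  rowsum (set_edge A x y true) k = rowsum A k + ((k == x) || (k == y)).
Proof.
by move=> sA Axy; have := rowsum_set_edge _ A x y true k sA; rewrite Axy; lia.
Qed.

(** Row [p] loses one entry and gains one, so an endpoint equal to [p] has no net change; hence the
    factors [x != p] and [y != p]. *)
Lemma rowsum_rewire n (A : 'M[bool]_n) p x y k :
  mxsym A -> A p x -> A p y = false ->
  rowsum (rewire A p x y) k + (k == x) * (x != p) =
  rowsum A k + (k == y) * (y != p).
Proof.
move=> sA Apx Apy; have sB := mxsym_set_edge _ A p x false sA.
have := rowsum_set_edge _ A p x false k sA; have := rowsum_set_edge _ _ p y true k sB.
rewrite Apx mxE Apy if_same -/(rewire A p x y).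
have [exy|nxy] := eqVneq x y; first by rewrite -exy Apx in Apy.
case: (eqVneq k p) => [->|nkp] /=; rewrite ?[p == _]eq_sym.
  by case: (x == p); case: (y == p); lia.
have [kx|_] := eqVneq k x; last first.
  by have [ky|_] := eqVneq k y; [rewrite -ky nkp; lia | lia].
by rewrite -kx nkp (negbTE (_ : k != y)) ?kx //; lia.
Qed.

Lemma rowsum_lt_witness n (A : 'M[bool]_n) i k : rowsum A i < rowsum A k ->
  exists2 u, A k u & A i u = false.
Proof.
move=> lt_ik; case: (pickP (fun u => A k u && ~~ A i u)) => [u|sub].
  by case/andP=> Aku /negbTE; exists u.
suff : rowsum A k <= rowsum A i by lia.
by apply: leq_sum => j _; have := sub j; case: (A k j); case: (A i j).
Qed.

Lemma sum1_ord_leq n (t : 'I_n) : \sum_(i < n | i <= t) 1 = t.+1.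
Proof.
rewrite -[RHS](card_ord t.+1) -sum1_card.
by rewrite (big_ord_widen _ (fun=> 1) (ltn_ord t)).
Qed.

Lemma ord_lt_neq n (a b : 'I_n) : a < b -> ((a == b) = false) * ((b == a) = false).
Proof. by move=> ab; rewrite -!val_eqE /=; split; lia. Qed.

(** * Filling the rows one at a time *)

Section Realization.
Variables (n : nat) (r : 'I_n -> nat).
Hypothesis r_anti : forall i j : 'I_n, i <= j -> r j <= r i.
Hypothesis r_dom : forall l,
  \sum_(i < n | i < l) r i <= \sum_(i < n) minn (r i) l.

(** This is where [r_dom] enters: a deficient row that no exchange can fill would force the reverse
    inequality. *)
Lemma partial_realization_deficient_sum (t : 'I_n) A :
  partial_realization r t A -> rowsum A t < r t ->
  \sum_(i < n | i <= t) rowsum A i < \sum_(i < n) minn (r i) t.+1.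
Proof.
move=> [_ leA _ _] ltt; apply: leq_trans (r_dom t.+1).
rewrite (bigD1 t) //= [X in _ < X](bigD1 t) //= -addSn leq_add //.
exact: leq_sum.
Qed.

Lemma partial_realization_improve (t : 'I_n) A :
  partial_realization r t A -> rowsum A t < r t ->
  exists2 B, partial_realization r t B & rowsum A t < rowsum B t.
Proof.
move=> pA ltt; have [sA leA eqA zA] := pA.
(* Rows before [t] are full and bounded by [r], so a lower bound keeps them exact; rows beyond [t]
   may lose entries. *)
have improved B : mxsym B -> null_beyond t B ->
    (forall k, rowsum B k <= r k) ->
    (forall k : 'I_n, k <= t -> rowsum A k + (k == t) <= rowsum B k) ->
    exists2 B, partial_realization r t B & rowsum A t < rowsum B t.
  move=> sB zB leB geB; exists B; last by have := geB t; rewrite eqxx addn1; apply.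
  split=> // i it; have := leB i; have := geB i (ltnW it); rewrite eqA //; lia.
(* Row [i] is full, and [r i >= r t] exceeds the sum of row [t]. *)
have wit (i : 'I_n) : i < t -> exists2 u, A u i & A u t = false.
  move=> it; have [u Aiu Atu] : exists2 u, A i u & A t u = false.
    apply: rowsum_lt_witness; rewrite (eqA i it).
    by apply: leq_trans ltt _; apply: r_anti; exact: ltnW.
  by exists u; rewrite sA.
have bumped B : mxsym B -> null_beyond t B ->
    (forall k, rowsum B k = rowsum A k + (k == t)) ->
    exists2 B, partial_realization r t B & rowsum A t < rowsum B t.
  move=> sB zB eB; apply: (improved B) => // k; rewrite eB //.
  by case: (eqVneq k t) => [->|_]; have := leA k; lia.
(* t and a deficient i (possibly i = t) are not adjacent: join them. *)
case: (pickP (fun i => ~~ A t i && (rowsum A i < r i))) => [i|H0].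
  case/andP=> /negbTE Ati lti; apply: (improved (set_edge A t i true)).
  - exact: mxsym_set_edge.
  - by apply: null_beyond_set_edge; rewrite ?leqnn.
  - move=> k; rewrite rowsum_add //.
    by have := leA k; case: eqVneq => [->|_]; last case: eqVneq => [->|_]; lia.
  by move=> k _; rewrite rowsum_add // leq_add2l; case: (k == t).
have {}H0 i : rowsum A i < r i -> A t i.
  by move=> lti; have := H0 i; rewrite lti andbT => /negbT; rewrite negbK.
(* [t] is itself deficient, so it carries a loop, which the next exchange can spend. *)
have Att : A t t by exact: H0.
(* t misses some i < t: take a neighbour u of i not adjacent to t.  A loop u = i
   becomes the edge it; otherwise ui, tt become ut, ti. *)
case: (pickP (fun i : 'I_n => (i < t) && ~~ A t i)) => [i|H1].
  case/andP=> it /negbTE Ati; have [u Aui Aut] := wit i it.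
  have [nit nti] := ord_lt_neq _ _ _ it.
  have ntu : (t == u) = false by apply: contraFF Aut => /eqP <-.
  have [eui|nui] := eqVneq u i.
    rewrite eui in Aui Aut; apply: (bumped (rewire A i i t)) => [||k].
    - exact: mxsym_rewire.
    - by apply: null_beyond_rewire; rewrite ?leqnn ?orbT.
    by have := rowsum_rewire _ A i i t k sA Aui Aut; rewrite eqxx nti; clear; lia.
  pose B := rewire A u i t.
  have sB : mxsym B by exact: mxsym_rewire.
  have Btt : B t t by rewrite !mxE ntu nti !andbF.
  have niu : (i == u) = false by rewrite eq_sym; exact/negbTE.
  have Bti : B t i = false by rewrite !mxE ntu nti niu !andbF Ati.
  apply: (bumped (rewire B t t i)) => [||k].
  - exact: mxsym_rewire.
  - apply: null_beyond_rewire; rewrite ?leqnn //.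
    by apply: null_beyond_rewire; rewrite ?leqnn ?orbT.
  have := rowsum_rewire _ A u i t k sA Aui Aut.
  have := rowsum_rewire _ B t t i k sB Btt Bti.
  by rewrite ntu nit eqxx niu -/B; clear; lia.
have {}H1 (i : 'I_n) : i <= t -> A t i.
  rewrite leq_eqVlt => /orP[/eqP/val_inj -> //|it].
  by have := H1 i; rewrite it => /negbT; rewrite negbK.
(* From here on the neighbours supplied by [wit] lie beyond [t], hence differ from all vertices up
   to [t]. *)
have gt_t u : A u t = false -> t < u.
  by rewrite sA ltnNge => Atu; apply: contraFN Atu; exact: H1.
(* A vertex k > t below min(r k, t.+1) misses some i < t: ui becomes ut, and ik is
   added. *)
case: (pickP (fun k : 'I_n =>
    (t < k) && (rowsum A k < minn (r k) t.+1))) => [k|H2].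
  case/andP=> tk; rewrite leq_min => /andP[ltk ltk'].
  have Atk : A t k by exact: H0.
  (* Being adjacent to all of [0..t] would give [k] at least [t.+1] neighbours; the missed vertex is
     not [t], which is adjacent to [k]. *)
  have [i it Aki] : exists2 i : 'I_n, i < t & A k i = false.
    case: (pickP (fun i : 'I_n => (i <= t) && ~~ A k i)) => [i|full].
      rewrite leq_eqVlt => /andP[/orP[/eqP/val_inj->|it /negbTE]]; last by exists i.
      by rewrite sA Atk.
    suff : t.+1 <= rowsum A k by rewrite leqNgt ltk'.
    rewrite -sum1_ord_leq big_mkcond; apply: leq_sum => i _.
    by have := full i; case: (i <= t) => //= /negbT; rewrite negbK => ->.
  have [u Aui Aut] := wit i it; have tu := gt_t u Aut.
  have [_ nut] := ord_lt_neq _ _ _ tu.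
  have [nit nti] := ord_lt_neq _ _ _ it.
  have [nik nki] := ord_lt_neq _ _ _ (ltn_trans it tk).
  have [niu nui] := ord_lt_neq _ _ _ (ltn_trans it tu).
  have [ntk nkt] := ord_lt_neq _ _ _ tk.
  pose B := rewire A u i t.
  have sB : mxsym B by exact: mxsym_rewire.
  have nku : (k == u) = false by apply: contraFF Aut => /eqP <-; rewrite sA.
  have Bik : B i k = false by rewrite !mxE niu nit nku !andbF sA.
  have eB x : rowsum (set_edge B i k true) x = rowsum A x + (x == t) + (x == k).
    have := rowsum_rewire _ A u i t x sA Aui Aut.
    rewrite rowsum_add // -/B niu (eq_sym t) nut.
    by case: (eqVneq x i) => [->|_]; rewrite ?nik ?nit; clear; lia.
  apply: (improved (set_edge B i k true)).
  - exact: mxsym_set_edge.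
  - apply: null_beyond_set_edge; last by rewrite (ltnW it).
    by apply: null_beyond_rewire; rewrite ?leqnn ?orbT.
  - move=> x; rewrite eB; have := leA x; case: (eqVneq x t) => [->|_].
      by move: ltt; rewrite ntk; clear; lia.
    by case: (eqVneq x k) => [->|_]; move: ltk; clear; lia.
  by move=> x _; rewrite eB leq_addr.
(* i, j < t (possibly equal) are not adjacent: ui becomes ut and, to restore i,
   either the loop ii is added or wj becomes ij, which lowers only w > t. *)
case: (pickP (fun p : 'I_n * 'I_n =>
    [&& p.1 < t, p.2 < t & ~~ A p.1 p.2])) => [[i j]|H3].
  case/and3P=> /= it jt /negbTE Aij.
  have [u Aui Aut] := wit i it; have tu := gt_t u Aut.
  have [w Awj Awt] := wit j jt; have tw := gt_t w Awt.
  have [nit _] := ord_lt_neq _ _ _ it.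
  have [njt _] := ord_lt_neq _ _ _ jt.
  have [ntu nut] := ord_lt_neq _ _ _ tu.
  have [niu nui] := ord_lt_neq _ _ _ (ltn_trans it tu).
  have [nju nuj] := ord_lt_neq _ _ _ (ltn_trans jt tu).
  pose B := rewire A u i t.
  have sB : mxsym B by exact: mxsym_rewire.
  have zB : null_beyond t B by apply: null_beyond_rewire; rewrite ?leqnn ?orbT.
  have Bji : B j i = false by rewrite !mxE niu nju njt nit !andbF sA.
  have eB x := rowsum_rewire _ A u i t x sA Aui Aut.
  have [eij|nij] := eqVneq j i.
    rewrite eij in Bji; apply: (bumped (set_edge B i i true)) => [||x].
    - exact: mxsym_set_edge.
    - by apply: null_beyond_set_edge; rewrite ?(ltnW it).
    by have := eB x; rewrite rowsum_add // -/B niu ntu orbb; clear; lia.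
  have [njw nwj] := ord_lt_neq _ _ _ (ltn_trans jt tw).
  have [niw nwi] := ord_lt_neq _ _ _ (ltn_trans it tw).
  have [_ nwt] := ord_lt_neq _ _ _ tw.
  have Bjw : B j w by rewrite !mxE nju njt nwi (negbTE nij) /= sA.
  have eC x : rowsum (rewire B j w i) x + (x == w) = rowsum A x + (x == t).
    have := eB x; have := rowsum_rewire _ B j w i x sB Bjw Bji.
    by rewrite -/B niu ntu nwj (eq_sym i) (negbTE nij); clear; lia.
  apply: (improved (rewire B j w i)).
  - exact: mxsym_rewire.
  - by apply: null_beyond_rewire; rewrite ?(ltnW it) ?orbT.
  - by move=> k; have := eC k; case: (eqVneq k t) => [->|_];
      have := leA k; move: ltt; clear; lia.
  move=> k kt; have := eC k.
  by have [-> _] := ord_lt_neq _ _ _ (leq_ltn_trans kt tw); clear; lia.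
(* The first t.+1 vertices are now a clique with loops, and each later one is
   adjacent to at least min(r k, t.+1) of them. *)
suff: \sum_(i < n) minn (r i) t.+1 <= \sum_(i < n | i <= t) rowsum A i.
  by rewrite leqNgt partial_realization_deficient_sum.
rewrite /rowsum exchange_big /=; apply: leq_sum => j _.
have [jt|tj] := leqP j t.
  apply: leq_trans (geq_minr _ _) _; rewrite -sum1_ord_leq.
  apply: leq_sum => i it; rewrite (_ : A i j) //.
  move: it jt; rewrite leq_eqVlt => /orP[/eqP/val_inj->|it]; first exact: H1.
  rewrite leq_eqVlt => /orP[/eqP/val_inj->|jt]; first by rewrite sA H1 // ltnW.
  by have := H3 (i, j); rewrite /= it jt => /negbT; rewrite negbK.
have := H2 j; rewrite tj /= ltnNge => /negbT; rewrite negbK => /leq_trans; apply.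
rewrite /rowsum [X in _ <= X]big_mkcond; apply: leq_sum => i _; rewrite sA.
by case: (leqP i t) => // ti; rewrite zA.
Qed.

Lemma partial_realization_exists t : t <= n -> exists A, partial_realization r t A.
Proof.
elim: t => [_|t IHt tn].
  have row0 i : rowsum (const_mx false : 'M_n) i = 0.
    by rewrite /rowsum big1 // => j _; rewrite mxE.
  by exists (const_mx false); split=> [i j|i|//|i j _ _]; rewrite ?row0 ?mxE.
have {IHt} [A pA] := IHt (ltnW tn); pose i := Ordinal tn.
(* Induction on the gap left in row [t], which each improvement shrinks. *)
have [m] := ubnP (r i - rowsum A i); elim: m A pA => // m IHm A pA gap.
have [lt_i|ge_i] := ltnP (rowsum A i) (r i).
  have [B pB AB] := partial_realization_improve i A pA lt_i.
  by apply: (IHm B pB); lia.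
have [sA leA eqA zA] := pA; exists A; split=> // [k|k l tk tl]; last first.
  by apply: zA; exact: ltnW.
rewrite ltnS leq_eqVlt => /orP[/eqP kt|/eqA //].
have -> : k = i by exact: val_inj.
by apply/eqP; rewrite eqn_leq leA.
Qed.

End Realization.

(** * The degree criterion for graphs with loops *)

Definition sym_realizable {n} (r : 'I_n -> nat) :=
  exists2 A : 'M[bool]_n, mxsym A & forall i, rowsum A i = r i.

Lemma sym_realizable_antitone n (r : 'I_n -> nat) :
  (forall i j : 'I_n, i <= j -> r j <= r i) ->
  sym_realizable r <->
  (forall l, \sum_(i < n | i < l) r i <= \sum_(i < n) minn (r i) l).
Proof.
move=> r_anti; split=> [[A sA rowA] l|r_dom]; last first.
  have [A [sA _ eqA _]] := partial_realization_exists n r r_anti r_dom n (leqnn n).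
  by exists A => // i; apply: eqA.
under eq_bigr do rewrite -rowA /rowsum.
(* Within the first [l] rows, column [j] has at most [l] ones, and at most [r j], its column sum
   being its row sum. *)
rewrite exchange_big /=; apply: leq_sum => j _; rewrite leq_min -rowA.
apply/andP; split.
  by rewrite /rowsum big_mkcond; apply: leq_sum => i _; rewrite sA; case: ifP.
have [ln|nl] := leqP l n.
  apply: (@leq_trans (\sum_(i < n | i < l) 1)).
    by apply: leq_sum => i _; case: (A i j).
  by rewrite -(big_ord_widen _ (fun=> 1) ln) sum1_card card_ord.
apply: (@leq_trans (\sum_(i < n) 1)); last by rewrite sum1_card card_ord ltnW.
by rewrite big_mkcond; apply: leq_sum => i _; case: ifP => // _; case: (A i j).
Qed.

(** Relabelling the vertices permutes rows and columns together, which preserves symmetry. *)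
Lemma sym_realizable_perm n (R R' : n.-tuple nat) : perm_eq R R' ->
  sym_realizable (tnth R) -> sym_realizable (tnth R').
Proof.
rewrite perm_sym => /tuple_permP[p eqR'] [A sA rowA].
exists (\matrix_(i, j) A (p i) (p j))%R => [i j|i]; first by rewrite !mxE sA.
have -> : tnth R' i = tnth R (p i) by rewrite (val_inj eqR') tnth_mktuple.
rewrite -rowA /rowsum [RHS](reindex_inj (@perm_inj _ p)).
by apply: eq_bigr => j _; rewrite mxE.
Qed.

(** * Conjugate partitions and majorization *)

Lemma sum_conjugate (R : seq nat) l :
  sumn (take l (conjugate R)) = \sum_(x <- R) minn x l.
Proof.
rewrite /conjugate -map_take take_iota sumnE big_map.
under eq_bigr do rewrite -sum1_count big_mkcond.
(* Count the Ferrers diagram the other way: [x] contributes the listed [k] with [k <= x]. *)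
rewrite exchange_big /=; apply: eq_big_seq => x xR.
have le_x : x <= \max_(y <- R) y by exact: leq_bigmax_seq.
rewrite -big_mkcond sum1_count.
(* [conjugate R] stops at the largest entry; capping [l] there does not affect [minn x l], since [x]
   is at most that entry. *)
set m := minn l _; have -> : minn x l = minn x m by lia.
elim: m => [|m IHm]; first by rewrite minn0.
by rewrite -[m.+1]addn1 iotaD count_cat IHm /=; lia.
Qed.

Lemma sort_conjugate (R : seq nat) : sort geq (conjugate R) = conjugate R.
Proof.
apply: sorted_sort; first by move=> x y z; lia.
rewrite /conjugate sorted_map.
apply: (sub_sorted _ (iota_sorted 1 _)) => i j ij /=.
by apply: sub_count => x; exact: leq_trans.
Qed.

Lemma take_sum_ord (n : nat) (s : n.-tuple nat) l :
  sumn (take l s) = \sum_(i < n | i < l) tnth s i.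
Proof.
rewrite sumnE -[in LHS](mkseq_nth 0 s) size_tuple /mkseq -map_take take_iota big_map.
have -> : iota 0 (minn l n) = [seq i <- iota 0 n | i < l].
  apply: (irr_sorted_eq ltn_trans ltnn); rewrite ?iota_ltn_sorted //.
    by apply: (sorted_filter ltn_trans); exact: iota_ltn_sorted.
  by move=> i; rewrite mem_filter !mem_iota; lia.
rewrite big_filter (_ : iota 0 n = index_iota 0 n) ?big_mkord; last first.
  by rewrite /index_iota subn0.
by apply: eq_bigr => i _; rewrite (tnth_nth 0).
Qed.

Lemma sumn_conjugate (R : seq nat) : sumn (conjugate R) = sumn R.
Proof.
rewrite -[in LHS](take_size (conjugate R)) sum_conjugate sumnE.
rewrite size_map size_iota; apply: eq_big_seq => x xR.
by apply/minn_idPl; exact: leq_bigmax_seq.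
Qed.

(** Sorting absorbs the reversal, and realizability ignores the order of [R], so the criterion for
    decreasing sequences applies; the totals always agree. *)
Lemma sym_realizable_conjugate n (R : n.-tuple nat) :
  sym_realizable (tnth R) <-> majorized_by (rev R) (conjugate R).
Proof.
pose s := [tuple of sort geq R].
have perm_sR : perm_eq s R by rewrite perm_sort.
have sort_rev : sort geq (rev R) = s.
  apply/perm_sortP; rewrite ?perm_rev //.
  - by move=> x y; exact: leq_total.
  - by move=> x y z; lia.
  - by move=> x y /=; rewrite andbC => /anti_leq.
have s_anti (i j : 'I_n) : i <= j -> tnth s j <= tnth s i.
  move=> ij; rewrite !(tnth_nth 0).
  have geq_trans : transitive geq by move=> x y z; lia.
  have sorted_s : sorted geq s by apply: sort_sorted => x y; exact: leq_total.
  by apply: (sorted_leq_nth geq_trans leqnn 0 sorted_s i j);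
    rewrite ?inE ?size_tuple.
have {}perm_iff : sym_realizable (tnth R) <-> sym_realizable (tnth s).
  by split; apply: sym_realizable_perm; rewrite // perm_sym.
rewrite perm_iff sym_realizable_antitone // /majorized_by.
rewrite sort_rev sort_conjugate sumn_rev sumn_conjugate.
have eqs l : (sumn (take l s) <= sumn (take l (conjugate R))) =
             (\sum_(i < n | i < l) tnth s i <= \sum_(i < n) minn (tnth s i) l).
  by rewrite take_sum_ord sum_conjugate -(perm_big _ perm_sR) big_tuple.
by split=> [H|[H _] l]; [split=> // l; rewrite eqs | rewrite -eqs].
Qed.

(** * Transfer to the reflection class *)

Theorem theorem7 (n : nat) (R S : n.-tuple nat) (n_gt0 : 1 <= n)
    (R_le : forall i : 'I_n, tnth R i <= n)
    (S_le : forall j : 'I_n, tnth S j <= n)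
    (sum_eq : \sum_(i < n) tnth R i = \sum_(j < n) tnth S j) :
  refl_p1_class R S != set0 <->
  S = rev_tuple R /\ majorized_by (rev R) (conjugate R).
Proof.
have tnth_rev (i : 'I_n) : tnth (rev_tuple R) i = tnth R (rev_ord i).
  by rewrite !(tnth_nth 0) /= nth_rev size_tuple.
rewrite -sym_realizable_conjugate; split.
  case/set0Pn=> A; rewrite inE => /and3P[/forallP rowA /forallP colA /forallP symA].
  have {}symA i j : A i j = A (rev_ord j) (rev_ord i).
    by have /forallP/(_ j)/eqP := symA i.
  split.
    (* The reflection carries column [j] to row [rev_ord j]. *)
    apply: eq_from_tnth => j; rewrite tnth_rev -(eqP (colA j)) -(eqP (rowA _)).
    rewrite (reindex_inj rev_ord_inj); apply: eq_bigr => i _.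
    by rewrite symA rev_ordK.
  exists (\matrix_(i, j) A i (rev_ord j))%R => [i j|i].
    by rewrite !mxE symA rev_ordK.
  rewrite -(eqP (rowA i)) [RHS](reindex_inj rev_ord_inj).
  by apply: eq_bigr => j _; rewrite mxE.
case=> -> [B symB rowB]; apply/set0Pn; exists (\matrix_(i, j) B i (rev_ord j))%R.
rewrite inE; apply/and3P; split; apply/forallP=> i; last 1 first.
- by apply/forallP=> j; rewrite !mxE rev_ordK symB.
- rewrite -rowB /rowsum [X in _ == X](reindex_inj rev_ord_inj).
  by apply/eqP/eq_bigr => j _; rewrite mxE.
(* Column [i] is column [rev_ord i] of [B], which by symmetry is its row [rev_ord i]. *)
rewrite tnth_rev -rowB /rowsum; apply/eqP/eq_bigr => j _.
by rewrite mxE symB.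
Qed.
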